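(* Let $n\ge 8$. Then the set $\{\eta(\Gamma(G)) : \Gamma(G) \text{ a signed graph whose underlying graph } G \text{ is a bicyclic graph on } n \text{ vertices}\}$ equals $\{0,1,2,\ldots,n-4\}$.
   Context: A signed graph $\Gamma(G)=(G,\sigma)$ consists of a simple graph $G$ and a map $\sigma:E(G)\to\{+,-\}$ (an arbitrary sign assignment, all-positive allowed); its adjacency matrix has entry $\sigma(v_iv_j)$ for edges and $0$ otherwise, and $\eta(\Gamma(G))$ is the multiplicity of $0$ as an eigenvalue. A bicyclic graph is a connected simple graph with $|E|=|V|+1$. *)

(* Defs.v *)
From HB Require Import structures.
From mathcomp Require Import all_boot all_order all_algebra.

Set Implicit Arguments.
Unset Strict Implicit.
Unset Printing Implicit Defensive.

Import GRing.Theory.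
Local Open Scope ring_scope.

Record sgraph (V : finType) := SGraph {
  adj : rel V;
  adj_sym : symmetric adj;
  adj_irrefl : irreflexive adj
}.

Definition edges (V : finType) (G : sgraph V) : {set {set V}} :=
  [set [set p.1; p.2] | p : V * V & adj G p.1 p.2].

Definition edge (V : finType) (G : sgraph V) := {e : {set V} | e \in edges G}.

Definition connected (V : finType) (G : sgraph V) : Prop :=
  forall u v : V, connect (adj G) u v.

(* The empty graph is excluded by the edge count. *)
Definition bicyclic (V : finType) (G : sgraph V) : Prop :=
  connected G /\ #|edges G| = #|V|.+1.

(* A sign is a boolean: [true] stands for -, [false] for +. *)
Record signed_graph (V : finType) := SignedGraph {
  underlying : sgraph V;
  sign : edge underlying -> bool
}.

(* [insub [set u; v]] is the edge uv if u and v are adjacent, and [None]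
   otherwise (in particular when u = v). *)
Definition adjacency (R : realFieldType) (n : nat)
    (Gam : signed_graph 'I_n) : 'M[R]_n :=
  \matrix_(i, j)
    if insub [set i; j] is Some e then (-1) ^+ sign (s := Gam) e else 0.

Definition nullity (R : realFieldType) (n : nat)
    (Gam : signed_graph 'I_n) : nat :=
  mup 0 (char_poly (adjacency R Gam)).

(* Main.v *)
(* A symmetric matrix over a real field has nullity n minus its rank. A bicyclic graph on at
   least 6 vertices has a vertex u and an edge cd avoiding u and its neighbours; with any
   neighbour v of u, the rows u, v, c, d are independent, so the rank is at least 4.
   Conversely every rank r in [4, n] occurs: take K4 minus an edge on {0, 1, 2, 3} with one
   negative edge chosen so that it is nonsingular, and hang pendant paths of length 2 and then
   pendant vertices at a hub. Each path adds 2 to the rank. At a hub of degree 3 the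
   pendant vertices add nothing; at a hub of degree 2 the first one adds 1, the others nothing. *)
Require Import Defs.
From HB Require Import structures.
From mathcomp Require Import all_boot all_order all_algebra.
From mathcomp Require Import zify ring lra.

Set Implicit Arguments.
Unset Strict Implicit.
Unset Printing Implicit Defensive.

Import Order.TTheory GRing.Theory Num.Theory.
Local Open Scope ring_scope.

(** * Nullity and rank of a symmetric matrix *)

(* Sylvester's identity: the determinant of [xI, C; R, I] computed by clearing either block. *)
Lemma char_poly_mulmxC (F : comNzRingType) (n r : nat)
    (C : 'M[F]_(n, r)) (B : 'M[F]_(r, n)) :
  'X^r * char_poly (C *m B) = 'X^n * char_poly (B *m C).
Proof.
pose Cp := map_mx polyC C; pose Bp := map_mx polyC B.
pose N : 'M_(n + r) := block_mx 'X%:M Cp Bp 1%:M.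
have -> : char_poly (C *m B) = \det N.
  have <- : \det (N *m block_mx 1%:M 0 (- Bp) 1%:M) = \det N.
    by rewrite det_mulmx det_lblock !det1 !mulr1.
  rewrite mulmx_block !mulmx1 !mulmx0 !mul1mx !add0r subrr det_ublock det1 mulr1.
  by rewrite mulmxN /char_poly /char_poly_mx map_mxM.
have <- : \det (block_mx 1%:M 0 (- Bp) 'X%:M *m N) = 'X^r * \det N.
  by rewrite det_mulmx det_lblock det1 mul1r det_scalar.
rewrite mulmx_block !mul1mx !mul0mx !addr0 mulmx1 mul_mx_scalar mul_scalar_mx.
rewrite scalerN addNr det_ublock det_scalar; congr (_ * _).
by rewrite mulNmx addrC /char_poly /char_poly_mx map_mxM.
Qed.

Lemma row_mul_tr_eq0 (F : realFieldType) (n : nat) (w : 'rV[F]_n) :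
  w *m w^T = 0 -> w = 0.
Proof.
move=> /matrixP /(_ 0 0); rewrite !mxE => h.
apply/rowP => j; rewrite mxE.
have h2 : \sum_k w 0 k ^+ 2 = 0.
  by rewrite -[RHS]h; apply: eq_bigr => k _; rewrite mxE expr2.
have /psumr_eq0P : forall k : 'I_n, true -> 0 <= w 0 k ^+ 2.
  by move=> k _; exact: sqr_ge0.
by move=> /(_ h2 j isT) /eqP; rewrite sqrf_eq0 => /eqP.
Qed.

(* With M = C B a full rank factorisation, B C is invertible because M is symmetric and a
   sum of squares vanishes only trivially. *)
Lemma mup0_char_poly_sym (F : realFieldType) (n : nat) (M : 'M[F]_n) :
  M^T = M -> mup 0 (char_poly M) = (n - \rank M)%N.
Proof.
move=> symM.
pose C := col_base M; pose B := row_base M.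
have unitBC : B *m C \in unitmx.
  rewrite -row_free_unit; apply: inj_row_free => v vBC0.
  have wM0 : v *m B *m M = 0.
    by rewrite -[X in _ *m X]mulmx_base mulmxA -(mulmxA v) vBC0 mul0mx.
  (* With w = v B = y M, symmetry gives w w^T = w M y^T, and w M = v (B C) B = 0. *)
  have /submxP[y wy] : (v *m B <= M)%MS.
    by apply: submx_trans (submxMl _ _) _; rewrite eq_row_base.
  have w0 : v *m B = 0.
    by apply: row_mul_tr_eq0; rewrite {2}wy trmx_mul symM mulmxA wM0 mul0mx.
  by apply: (row_free_inj (row_base_free M)); rewrite w0 mul0mx.
have nroot : ~~ root (char_poly (B *m C)) 0.
  rewrite /root horner_coef0 char_poly_det mulf_eq0 signr_eq0 /=.
  by rewrite -unitfE -unitmxE.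
(* As 0 is not a root of [char_poly (B *m C)], comparing multiplicities of 0 on both sides gives
   rank + [mup] = n. *)
have := char_poly_mulmxC C B; rewrite mulmx_base => /(congr1 (mup 0)).
have mupXn k : mup 0 ('X^k : {poly F}) = k.
  by have := mup_XsubCX k (0 : F) 0; rewrite subr0 eqxx.
rewrite (mupMl _ nroot) mupM ?mupXn ?monic_neq0 ?monicXn ?char_poly_monic //.
by move=> /(congr1 (subn^~ (\rank M))) /=; rewrite addKn.
Qed.

Lemma rank_rowsub_free (F : fieldType) (m n p : nat) (f : 'I_p -> 'I_m)
    (A : 'M[F]_(m, n)) :
  (forall x : 'I_p -> F, (forall j, \sum_k x k * A (f k) j = 0) -> forall k, x k = 0) ->
  \rank (rowsub f A) = p.
Proof.
move=> h; apply/eqP/(@inj_row_free _ _ _ (rowsub f A)) => v v0.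
apply/rowP => k; rewrite mxE; apply: h => j.
move/rowP/(_ j): v0; rewrite !mxE => v0.
by rewrite -[RHS]v0; apply: eq_bigr => i _; rewrite mxE.
Qed.

(** * Edges, adjacency entries and degrees *)

Lemma in_edges (V : finType) (G : sgraph V) u v :
  ([set u; v] \in edges G) = adj G u v.
Proof.
apply/imsetP/idP => [[[a b]]|uv]; last by exists (u, v); rewrite ?inE.
rewrite inE /= => ab e.
have nab : a != b by apply: contraTneq ab => ->; rewrite adj_irrefl.
have : b \in [set u; v] by rewrite e set22.
have : a \in [set u; v] by rewrite e set21.
rewrite !inE => /orP[]/eqP ea /orP[]/eqP eb; move: nab ab; rewrite ea eb ?eqxx //.
by rewrite adj_sym.
Qed.

Lemma adjacencyE (R : realFieldType) n (Gam : signed_graph 'I_n) i j :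
  (adjacency R Gam i j != 0) = adj (underlying Gam) i j.
Proof.
rewrite mxE -in_edges; case: insubP => [e -> _|/negPf ->]; last by rewrite eqxx.
by rewrite signr_eq0.
Qed.

Lemma adjacency_sym (R : realFieldType) n (Gam : signed_graph 'I_n) :
  (adjacency R Gam)^T = adjacency R Gam.
Proof. by apply/matrixP => i j; rewrite !mxE setUC. Qed.

Lemma nullityE (R : realFieldType) n (Gam : signed_graph 'I_n) :
  nullity R Gam = (n - \rank (adjacency R Gam))%N.
Proof. exact/mup0_char_poly_sym/adjacency_sym. Qed.

(** Each edge is counted once, at its larger endpoint; this suits graphs built by joining each
    vertex to earlier ones. *)
Lemma card_edges n (G : sgraph 'I_n) :
  #|edges G| = (\sum_(v < n) \sum_(w < n) ((w < v) && adj G v w))%N.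
Proof.
transitivity #|[set p : 'I_n * 'I_n | (p.2 < p.1)%N && adj G p.1 p.2]|; last first.
  rewrite pair_big /= -sum1_card [RHS](big_mkcond xpredT) /= big_mkcond /=.
  by apply: eq_bigr => p _; rewrite inE; case: andb.
rewrite -(@card_in_imset _ _ (fun p : 'I_n * 'I_n => [set p.1; p.2])).
  congr #|pred_of_set _|; apply/setP => e; apply/imsetP/imsetP => -[[a b]]; last first.
    by rewrite inE /= => /andP[_ ab] ->; exists (a, b); rewrite ?inE.
  rewrite inE /= => ab ->.
  case: (ltngtP b a) => [ba|ba|/val_inj ba].
  - by exists (a, b); rewrite ?inE /= ?ba.
  - by exists (b, a); rewrite ?inE /= ?ba 1?adj_sym // setUC.
  - by rewrite ba adj_irrefl in ab.
move=> [a b] [c d]; rewrite !inE /= => /andP[ba _] /andP[dc _] e.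
have : b \in [set c; d] by rewrite -e set22.
have : a \in [set c; d] by rewrite -e set21.
rewrite !inE => /orP[]/eqP ea /orP[]/eqP eb; subst a b; rewrite ?ltnn // in ba *.
by rewrite ltnNge ltnW in ba.
Qed.

Lemma sum_deg n (G : sgraph 'I_n) : (\sum_v \sum_w adj G v w = 2 * #|edges G|)%N.
Proof.
rewrite card_edges mul2n -addnn [X in (_ + X)%N]exchange_big -big_split.
apply: eq_bigr => v _; rewrite -big_split; apply: eq_bigr => w _ /=.
rewrite (adj_sym _ w).
by case: ltngtP => [||/val_inj ->]; rewrite ?adj_irrefl //= addn0.
Qed.

Lemma deg_gt0 n (G : sgraph 'I_n) v :
  (1 < n)%N -> connected G -> (0 < \sum_w adj G v w)%N.
Proof.
move=> n1 cG.
have [u uv] : exists u : 'I_n, v != u.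
  pose a : 'I_n := Ordinal n1; pose b : 'I_n := Ordinal (ltnW n1).
  by case: (eqVneq v a) => [->|]; [exists b | exists a].
have /connectP[[|w p] /=] := cG v u; first by move=> _ uv'; rewrite uv' eqxx in uv.
by move=> /andP[vw _] _; rewrite (bigD1 w) //= vw.
Qed.

(** * Rank at least 4 for bicyclic graphs *)

(* An edge cd meeting neither u nor N(u) exists as soon as the degrees over N(u) sum to less
   than the number of edges; a vertex u of minimal degree has this property. *)
Lemma bicyclic_far_edge n (G : sgraph 'I_n) :
  (6 <= n)%N -> bicyclic G ->
  exists u v c d, [/\ adj G u v, adj G c d, ~~ adj G u c & ~~ adj G u d].
Proof.
move=> n6 [cG eG]; rewrite card_ord in eG.
pose deg v := (\sum_w adj G v w)%N.
have sdeg : (\sum_v deg v = 2 * n.+1)%N by rewrite sum_deg eG.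
have dpos v : (0 < deg v)%N by apply: deg_gt0 => //; lia.
have n0 : (0 < n)%N by lia.
case: (arg_minnP deg (isT : xpredT (Ordinal n0))) => u _ umin.
have [v uv] : exists v, adj G u v.
  apply/existsP; have := dpos u; apply: contraTT => /existsPn nadj.
  by rewrite -leqNgt leqn0 /deg sum_nat_eq0; apply/forallP => w; rewrite (negPf (nadj w)).
have degu : (deg u = #|[pred w | adj G u w]|)%N.
  by rewrite /deg -sum1_card [RHS]big_mkcond; apply: eq_bigr => w _ /=; rewrite inE; case: adj.
have degN w : (deg w <= n.-1)%N.
  rewrite /deg (bigD1 w) //= adj_irrefl add0n.
  have : (\sum_(i | i != w) adj G w i <= \sum_(i | i != w) 1)%N.
    by apply: leq_sum => i _; exact: leq_b1.
  by rewrite sum1_card cardC1 card_ord.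
(* The mean degree is 2 + 2/n, so [deg u] is 1 or 2. If 1, the sum is a single degree, at most n -
   1. If 2, the n - 2 non-neighbours of u take at least 2(n - 2) of the total 2(n + 1), which leaves
   at most 6 <= n. *)
have sumN : (\sum_(w | adj G u w) deg w <= n)%N.
  have umin2 : (deg u <= 2)%N.
    have : (\sum_(w < n) deg u <= \sum_w deg w)%N by apply: leq_sum => w _; exact: umin.
    by rewrite sdeg sum_nat_const card_ord; nia.
  have far : ((n - deg u) * deg u <= \sum_(w | ~~ adj G u w) deg w)%N.
    have -> : (n - deg u = #|[predC [pred w | adj G u w]]|)%N.
      have := cardC [pred w | adj G u w]; rewrite -degu card_ord.
      by move=> /(congr1 (subn^~ (deg u))) /=; rewrite addKn.
    by rewrite -sum_nat_const; apply: leq_sum => w _; exact: umin.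
  have := sdeg; rewrite (bigID (adj G u)) /= => split_sum.
  have near : (\sum_(w | adj G u w) deg w <= deg u * n.-1)%N.
    by rewrite degu -sum_nat_const; apply: leq_sum => w _.
  move: far near split_sum umin2 (dpos u).
  move: (\sum_(w | adj G u w) deg w)%N (\sum_(w | ~~ adj G u w) deg w)%N (deg u).
  by move=> S T [|[|[|d]]] //; lia.
suff /existsP[c /existsP[d /and3P[cd uc ud]]] :
  [exists c, exists d, [&& adj G c d, ~~ adj G u c & ~~ adj G u d]] by exists u, v, c, d.
(* If every edge had an endpoint in N(u), charging each ordered adjacent pair to such endpoints
   would give 2(n + 1) <= 2 * (degree sum over N(u)). *)
move: sumN; apply: contraLR => /existsPn noE; rewrite -ltnNge.
have /leq_trans : (\sum_a \sum_b adj G a b <=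
    \sum_a \sum_b (adj G u a * adj G a b + adj G u b * adj G a b))%N.
  apply: leq_sum => a _; apply: leq_sum => b _.
  have := noE a; rewrite negb_exists => /forallP/(_ b).
  by case: (adj G a b) (adj G u a) (adj G u b) => [] [] [].
have near : (\sum_a \sum_b adj G u a * adj G a b = \sum_(w | adj G u w) deg w)%N.
  rewrite [RHS]big_mkcond; apply: eq_bigr => a _; rewrite -big_distrr /=.
  by case: adj; rewrite ?mul1n ?mul0n.
have -> : (\sum_a \sum_b (adj G u a * adj G a b + adj G u b * adj G a b) =
    2 * \sum_(w | adj G u w) deg w)%N.
  under eq_bigr do rewrite big_split.
  rewrite big_split /= near mul2n -addnn [X in (_ + X)%N]exchange_big -near /=.
  by congr addn; apply: eq_bigr => a _; apply: eq_bigr => b _; rewrite (adj_sym G b).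
rewrite sum_deg eG => /(_ _ (leqnn _)); lia.
Qed.

Lemma rank_bicyclic_ge4 (R : realFieldType) n (Gam : signed_graph 'I_n) :
  (6 <= n)%N -> bicyclic (underlying Gam) -> (4 <= \rank (adjacency R Gam))%N.
Proof.
move=> n6 /(bicyclic_far_edge n6)[u [v [c [d [uv cd uc ud]]]]].
pose f (k : 'I_4) := tnth [tuple u; v; c; d] k.
suff <- : \rank (rowsub f (adjacency R Gam)) = 4%N by apply/mxrankS/rowsub_sub.
apply: rank_rowsub_free => x eqs.
have symA i j : adjacency R Gam i j = adjacency R Gam j i.
  by have /matrixP/(_ j i) := adjacency_sym R Gam; rewrite [LHS]mxE.
have nz i j : adj (underlying Gam) i j -> adjacency R Gam i j != 0.
  by rewrite -(adjacencyE R).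
have z i j : ~~ adj (underlying Gam) i j -> adjacency R Gam i j = 0.
  by rewrite -(adjacencyE R) negbK => /eqP.
have diag i : adjacency R Gam i i = 0 by apply: z; rewrite adj_irrefl.
pose X i : R := x (inord i).
have {}eqs j : X 0 * adjacency R Gam u j + X 1 * adjacency R Gam v j +
               X 2 * adjacency R Gam c j + X 3 * adjacency R Gam d j = 0.
  rewrite -[RHS](eqs j) !big_ord_recr big_ord0 /= add0r /X /f.
  by rewrite !(tnth_nth u) /=; congr (_ * _ + _ * _ + _ * _ + _ * _);
     congr x; apply: val_inj; rewrite /= inordK.
(* Among the four rows only v is nonzero in column u. Once [X 1] vanishes, columns c and d isolate
   [X 3] and [X 2], and column v then isolates [X 0]. *)
have X1 : X 1 = 0.
  have := eqs u; rewrite diag (symA c u) (symA d u) (z _ _ uc) (z _ _ ud) !mulr0 add0r !addr0.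
  by move/eqP; rewrite mulf_eq0 (symA v u) (negPf (nz _ _ uv)) orbF => /eqP.
have X3 : X 3 = 0.
  have := eqs c; rewrite X1 diag (z _ _ uc) mul0r !mulr0 !add0r.
  by move/eqP; rewrite mulf_eq0 (symA d c) (negPf (nz _ _ cd)) orbF => /eqP.
have X2 : X 2 = 0.
  have := eqs d; rewrite X1 diag (z _ _ ud) mul0r !mulr0 !add0r addr0.
  by move/eqP; rewrite mulf_eq0 (negPf (nz _ _ cd)) orbF => /eqP.
have X0 : X 0 = 0.
  have := eqs v; rewrite X1 X2 X3 !mul0r !addr0.
  by move/eqP; rewrite mulf_eq0 (negPf (nz _ _ uv)) orbF => /eqP.
move=> k; rewrite -[k]inord_val.
by case: k => [[|[|[|[|k]]]]] //= _.
Qed.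

(** * Model graphs of prescribed rank *)

(* Adjacency of i to a smaller vertex j in the graph of rank r: K4 minus the edge {0, 3} on the
   first four vertices, then paths hub - 2m - 2m+1 below r, then pendant vertices. The hub is
   0 for r odd and 1 for r even, whence j + odd r = 1. *)
Definition low_adj (r i j : nat) : bool :=
  (j < i)%N && [|| (i < 4)%N && (i <= j + 2)%N,
                   [&& 4 <= i, odd i, i < r & j.+1 == i]%N
                 | [&& 4 <= i, ~~ (odd i && (i < r)) & j + odd r == 1]%N].

Definition nat_adj (r i j : nat) : bool := low_adj r i j || low_adj r j i.

Lemma nat_adj_sym r : symmetric (nat_adj r).
Proof. by move=> i j; rewrite /nat_adj orbC. Qed.

Lemma nat_adj_irr r : irreflexive (nat_adj r).
Proof. by move=> i; rewrite /nat_adj /low_adj ltnn. Qed.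

Definition model_graph (r n : nat) : sgraph 'I_n :=
  @SGraph 'I_n (fun i j => nat_adj r i j)
    (fun i j => nat_adj_sym r i j) (fun i => nat_adj_irr r i).

(* Only the edge {1, 3} is negative. *)
Definition model (r n : nat) : signed_graph 'I_n :=
  @SignedGraph 'I_n (model_graph r n) (fun e => \prod_(i in val e) (i : nat) == 3)%N.

(** Indexed by naturals, independently of n. A product of two naturals is 3 only for the pair {1,
    3}, the negative edge. *)
Definition entry (R : nzRingType) (r i j : nat) : R :=
  if nat_adj r i j then (-1) ^+ (i * j == 3)%N else 0.

Lemma adjacency_model (R : realFieldType) r n i j :
  adjacency R (model r n) i j = entry R r i j.
Proof.
rewrite mxE /entry; case: insubP => [e|]; rewrite in_edges /=; last by move=> /negPf ->.
move=> ij ve.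
have nij : i != j by apply: contraTneq ij => ->; rewrite nat_adj_irr.
by rewrite ij ve big_setU1 ?inE // big_set1.
Qed.

(** A spanning tree rooted at 0; [~~ odd r], read as a number, is the hub. *)
Definition parent (r i : nat) : nat :=
  if (i < 4)%N then i.-1 else if odd i && (i < r)%N then i.-1 else ~~ odd r.

Lemma parent_lt r i : (0 < i)%N -> (parent r i < i)%N.
Proof.
rewrite /parent; case: ifP => [_|i4]; first by lia.
by case: ifP => [_|_]; [|case: (odd r)]; lia.
Qed.

(** Besides the n - 1 tree edges there are just {0, 2} and {1, 3}; the sum form makes the total n +
    1 computable termwise. *)
Lemma low_adjE r i j :
  low_adj r i j = ((0 < i) * (j == parent r i) + (i == 2) * (j == 0) + (i == 3) * (j == 1))%N
    :> nat.
Proof.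
rewrite /low_adj /parent; case: (ltnP i 4) => i4.
  by case: i i4 => [|[|[|[|i]]]] //= _; lia.
case: (boolP (odd i && (i < r)%N)) => oi; first by lia.
by case: (odd r); lia.
Qed.

Lemma low_adj_parent r i : (0 < i)%N -> low_adj r i (parent r i).
Proof.
move=> i0; have := low_adjE r i (parent r i); rewrite eqxx i0.
by case: low_adj => //=; lia.
Qed.

Lemma model_connected r n : connected (model_graph r n).
Proof.
have csym : connect_sym (adj (model_graph r n)).
  by apply: sym_connect_sym => i j; exact: nat_adj_sym.
have toroot (m : nat) (i z : 'I_n) : (i <= m)%N -> z = 0%N :> nat ->
  connect (adj (model_graph r n)) i z.
  elim: m i => [|m IH] i im z0.
    by have -> : i = z by apply: val_inj; rewrite /= z0; lia.
  case: (posnP i) => i0; first by apply: IH => //; rewrite i0.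
  have ji := parent_lt r i0.
  have jn : (parent r i < n)%N by apply: ltn_trans ji _.
  apply: (connect_trans (y := Ordinal jn)); last by apply: IH => //=; lia.
  by apply: connect1; rewrite /= /nat_adj low_adj_parent.
move=> u v; have n0 : (0 < n)%N by apply: leq_ltn_trans (ltn_ord u).
apply: (connect_trans (y := Ordinal n0)); first exact: toroot (leqnn _) _.
by rewrite csym; exact: toroot (leqnn _) _.
Qed.

Lemma sum_eq_nat n p : (\sum_(w < n) (w == p :> nat) = (p < n))%N.
Proof.
case: (ltnP p n) => pn.
  rewrite (bigD1 (Ordinal pn)) //= eqxx big1 // => i.
  by rewrite -val_eqE /= => /negPf ->.
by rewrite big1 // => i _; case: eqP => // ip; have := ltn_ord i; lia.
Qed.

Lemma model_edges r n : (4 <= n)%N -> #|edges (model_graph r n)| = n.+1.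
Proof.
move=> n4; rewrite card_edges /=.
transitivity (\sum_(v < n) \sum_(w < n) ((0 < v) * (w == parent r v :> nat) +
    (v == 2 :> nat) * (w == 0 :> nat) + (v == 3 :> nat) * (w == 1 :> nat)))%N.
  apply: eq_bigr => v _; apply: eq_bigr => w _; rewrite -low_adjE; congr nat_of_bool.
  by rewrite /nat_adj /low_adj; case: ltngtP => //=; rewrite ?orbF.
transitivity (\sum_(v < n) ((0 < v) + (v == 2 :> nat) + (v == 3 :> nat)))%N.
  apply: eq_bigr => v _; rewrite !big_split /= -!big_distrr /= !sum_eq_nat.
  have -> : (0 < n)%N by lia.
  have -> : (1 < n)%N by lia.
  rewrite !muln1; congr (_ + _ + _)%N; case: (posnP v) => // v0.
  by rewrite (ltn_trans (parent_lt r v0)).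
rewrite !big_split /= !sum_eq_nat.
have : (\sum_(v < n) ((0 < v) + (v == 0 :> nat)) = n)%N.
  rewrite -[RHS]card_ord -sum1_card; apply: eq_bigr => v _.
  by case: (nat_of_ord v).
by rewrite big_split /= sum_eq_nat; lia.
Qed.

Lemma model_bicyclic r n : (4 <= n)%N -> bicyclic (underlying (model r n)).
Proof.
by move=> n4; split; [exact: model_connected|rewrite card_ord model_edges].
Qed.

(** * Nonsingularity of the leading block *)

Lemma sum_support (R : nmodType) (n : nat) (s : seq nat) (F : nat -> R) :
  uniq s -> all (fun k => k < n)%N s ->
  (forall k, (k < n)%N -> k \notin s -> F k = 0) ->
  \sum_(k < n) F k = \sum_(k <- s) F k.
Proof.
move=> us sn Fz; rewrite -(big_mkord xpredT) (bigID (mem s)) /=.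
rewrite [X in _ + X]big_nat_cond [X in _ + X]big1 ?addr0; last first.
  by move=> k /andP[kn]; exact: Fz.
rewrite -big_filter; apply: perm_big; apply: uniq_perm => //.
  by rewrite filter_uniq // iota_uniq.
move=> k; rewrite mem_filter mem_index_iota /=; case: (boolP (k \in s)) => //= ks.
by rewrite (allP sn _ ks).
Qed.

(** Leaves remove unknowns first, then the base graph leaves a small nonsingular system, and the
    ends of the paths come last. *)
Lemma model_kernel (R : realFieldType) (r : nat) (X : nat -> R) :
  (4 <= r)%N ->
  (forall i, (i < r)%N -> \sum_(k < r) X k * entry R r k i = 0) ->
  forall k, (k < r)%N -> X k = 0.
Proof.
move=> r4 eqs.
have zero k i : nat_adj r k i = false -> X k * entry R r k i = 0.
  by move=> h; rewrite /entry h mulr0.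
have pos k i : nat_adj r k i -> (k * i == 3)%N = false -> X k * entry R r k i = X k.
  by move=> h1 h2; rewrite /entry h1 h2 mulr1.
have neg k i : nat_adj r k i -> (k * i == 3)%N -> X k * entry R r k i = - X k.
  by move=> h1 h2; rewrite /entry h1 h2 mulrN1.
(* Neighbours of i already known to carry 0 may be dropped from the list s. *)
have col i (s : seq nat) : (i < r)%N -> uniq s -> all (fun k => k < r)%N s ->
    (forall k, (k < r)%N -> k \notin s -> nat_adj r k i -> X k = 0) ->
    \sum_(k <- s) X k * entry R r k i = 0.
  move=> ir us sr h; rewrite -[RHS](eqs _ ir).
  rewrite (sum_support (F := fun k => X k * entry R r k i) us sr) // => k kr ks.
  case: (boolP (nat_adj r k i)) => [ki|/negPf]; last exact: zero.
  by rewrite (h _ kr ks ki) mul0r.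
(* Vertex k + 1 ends a path, and k is its only neighbour. *)
have inner k : (4 <= k)%N -> (k.+1 < r)%N -> ~~ odd k -> X k = 0.
  move=> k4 kr ok; have := col k.+1 [:: k] kr isT.
  rewrite /= big_seq1 pos ?/nat_adj ?/low_adj; try lia.
  apply; first lia.
  by move=> j jr; rewrite inE; lia.
case: (boolP (odd r)) => odr.
(* Here r - 1 is a pendant vertex at the hub 0, so its column gives [X 0 = 0]. Columns 1, 2, 3
   become the system of a signed triangle, which is nonsingular, and column 0 then gives
   [X r.-1 = 0]. *)
- have x0 : X 0%N = 0.
    have := col r.-1 [:: 0%N].
    rewrite /= big_seq1 pos ?/nat_adj ?/low_adj; try lia.
    apply => //; try lia.
    by move=> j jr; rewrite inE; lia.
  have c1 : X 2 - X 3 = 0.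
    have := col 1%N [:: 2; 3]%N.
    rewrite /= !big_cons big_nil addr0 (pos 2%N) ?(neg 3%N) ?/nat_adj ?/low_adj //.
    apply => //; try lia.
    by move=> [|j] // jr; rewrite !inE; lia.
  have c2 : X 1 + X 3 = 0.
    have := col 2%N [:: 1; 3]%N.
    rewrite /= !big_cons big_nil addr0 (pos 1%N) ?(pos 3%N) ?/nat_adj ?/low_adj //.
    apply => //; try lia.
    by move=> [|j] // jr; rewrite !inE; lia.
  have c3 : - X 1 + X 2 = 0.
    have := col 3%N [:: 1; 2]%N.
    rewrite /= !big_cons big_nil addr0 (neg 1%N) ?(pos 2%N) ?/nat_adj ?/low_adj //.
    apply => //; try lia.
    by move=> [|j] // jr; rewrite !inE; lia.
  have x1 : X 1 = 0 by lra.
  have x2 : X 2 = 0 by lra.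
  have x3 : X 3 = 0 by lra.
  have last : X r.-1 = 0.
    have := col 0%N [:: r.-1].
    rewrite /= big_seq1 pos ?/nat_adj ?/low_adj; try lia.
    apply => //; try lia.
    move=> [|[|[|[|j]]]] // jr; rewrite !inE => jn ja; apply: inner; lia.
  move=> k kr; case: (ltnP k 4) => k4; first by move: k k4 kr => [|[|[|[|k]]]].
  case: (boolP (odd k)) => ok; last first.
    by case: (eqVneq k r.-1) => [-> //|kn]; apply: inner; lia.
  have := col k.-1 [:: k].
  rewrite /= big_seq1 pos ?/nat_adj ?/low_adj; try lia.
  apply => //; try lia.
  by move=> [|j] // jr; rewrite !inE; lia.
(* The negative edge {1, 3} separates columns 0 and 3, which force [X 1 = X 2 = 0]; columns 2 and 1
   then give [X 0] plus and minus [X 3]. *)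
have c0 : X 1 + X 2 = 0.
  have := col 0%N [:: 1; 2]%N.
  rewrite /= !big_cons big_nil addr0 (pos 1%N) ?(pos 2%N) ?/nat_adj ?/low_adj //.
  apply => //; try lia.
  by move=> j jr; rewrite !inE; lia.
have c2 : X 0 + X 1 + X 3 = 0.
  have := col 2%N [:: 0; 1; 3]%N.
  rewrite /= !big_cons big_nil addr0 (pos 0%N) ?(pos 1%N) ?(pos 3%N) ?/nat_adj ?/low_adj //.
  rewrite addrA; apply => //; try lia.
  by move=> j jr; rewrite !inE; lia.
have c3 : - X 1 + X 2 = 0.
  have := col 3%N [:: 1; 2]%N.
  rewrite /= !big_cons big_nil addr0 (neg 1%N) ?(pos 2%N) ?/nat_adj ?/low_adj //.
  apply => //; try lia.
  by move=> j jr; rewrite !inE; lia.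
have c1 : X 0 + X 2 - X 3 = 0.
  have := col 1%N [:: 0; 2; 3]%N.
  rewrite /= !big_cons big_nil addr0 (pos 0%N) ?(pos 2%N) ?(neg 3%N) ?/nat_adj ?/low_adj //.
  rewrite addrA; apply => //; try lia.
  by move=> j jr; rewrite !inE => jn ja; apply: inner; lia.
have x0 : X 0 = 0 by lra.
have x1 : X 1 = 0 by lra.
have x2 : X 2 = 0 by lra.
have x3 : X 3 = 0 by lra.
move=> k kr; case: (ltnP k 4) => k4; first by move: k k4 kr => [|[|[|[|k]]]].
case: (boolP (odd k)) => ok; last by apply: inner; lia.
have := col k.-1 [:: 1; k]%N.
rewrite /= !big_cons big_nil x1 mul0r add0r addr0 pos ?/nat_adj ?/low_adj; try lia.
apply; rewrite /= ?inE; try lia.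
by move=> j jr; rewrite !inE; lia.
Qed.

(** * Dependence of the remaining rows and rank of the models *)

Lemma entry_ge4 (R : nzRingType) (r i j : nat) :
  (4 <= i)%N -> entry R r i j = (nat_adj r i j)%:R.
Proof.
move=> i4; rewrite /entry; have -> : (i * j == 3)%N = false by case: j => [|j]; nia.
by case: nat_adj.
Qed.

(** Such a vertex is pendant at the hub. The bound admits i = r - 1 for r odd, the row that later
    ones repeat. *)
Lemma nat_adj_late (r i j : nat) :
  (4 <= i)%N -> ~~ (odd i && (i < r)%N) -> (r <= i.+1)%N ->
  nat_adj r i j = (j + odd r == 1)%N.
Proof.
move=> i4 /negPf oi ri.
have -> : nat_adj r i j = low_adj r i j.
  rewrite /nat_adj; suff -> : low_adj r j i = false by rewrite orbF.
  by apply/negP => /andP[ij /or3P[/andP[]|/and4P[]|/and3P[]]]; lia.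
rewrite /low_adj (andbA (odd i)) oi i4 (ltnNge i 4) i4 /= andb_idl // => /eqP.
by lia.
Qed.

(** For r even everything is hung at 1, so 0 and 3 keep their neighbours from the base graph. *)
Lemma nat_adj_base (r i j : nat) :
  (i == 0)%N || (i == 3)%N -> ~~ odd r -> nat_adj r i j = (j == 1)%N || (j == 2)%N.
Proof.
move=> i03 /negPf odr; case: (ltnP j 4) => j4.
  by case/orP: i03 => /eqP ->; move: j j4 => [|[|[|[|j]]]].
have -> : (j == 1)%N || (j == 2)%N = false by lia.
apply/norP; split; apply/negP => /andP[ij]; rewrite odr.
  by case/orP: i03 => /eqP i0; lia.
by case/or3P => [/andP[]|/and4P[]|/and3P[]]; lia.
Qed.

Lemma entry_odd_late (R : nzRingType) (r i j : nat) :
  odd r -> (5 <= r <= i)%N -> entry R r i j = entry R r r.-1 j.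
Proof.
by move=> odr ri; rewrite !entry_ge4 ?nat_adj_late //; lia.
Qed.

(** Rows 0 and 3 are e1 + e2 and -e1 + e2; half their difference is e1, the row of a vertex pendant
    at the hub 1. *)
Lemma entry_even_late (R : realFieldType) (r i j : nat) :
  ~~ odd r -> (4 <= r <= i)%N -> entry R r i j = 2^-1 * (entry R r 0 j - entry R r 3 j).
Proof.
move=> odr ri; rewrite entry_ge4 ?nat_adj_late; try lia.
rewrite (negPf odr) addn0 /entry !nat_adj_base //.
by move: j => [|[|[|j]]] /=; field.
Qed.

(** The first r rows are independent already on the first r columns, and all later rows lie in their
    span. *)
Lemma model_rank (R : realFieldType) (r n : nat) :
  (4 <= r <= n)%N -> \rank (adjacency R (model r n)) = r.
Proof.
move=> /andP[r4 rn]; set A := adjacency _ _.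
pose f : 'I_r -> 'I_n := widen_ord rn.
have rankf : \rank (rowsub f A) = r.
  apply: rank_rowsub_free => x eqs.
  have r0 : (0 < r)%N by lia.
  pose X k := x (insubd (Ordinal r0) k).
  have xE k : X (nat_of_ord k) = x k by rewrite /X valKd.
  move=> k; rewrite -xE; apply: (@model_kernel R r X r4) => // i ir.
  rewrite -[RHS](eqs (Ordinal (leq_trans ir rn))).
  by apply: eq_bigr => j _; rewrite xE adjacency_model.
rewrite -[RHS]rankf; apply/esym/eqmx_rank; rewrite rowsub_sub /=; apply/row_subP => i.
have rowf (k : 'I_n) : (k < r)%N -> (row k A <= rowsub f A)%MS.
  move=> kr; apply: (eq_row_sub (Ordinal kr)); rewrite row_rowsub.
  by congr row; apply: val_inj.
have rowA k j : row k A 0 j = entry R r k j by rewrite mxE adjacency_model.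
case: (ltnP i r) => [ir|ri]; first exact: rowf.
case: (boolP (odd r)) => odr.
  have rn' : (r.-1 < n)%N by lia.
  have -> : row i A = row (Ordinal rn') A; last by apply: rowf => /=; lia.
  by apply/rowP => j; rewrite !rowA; apply: entry_odd_late => //; lia.
have n0 : (0 < n)%N by lia.
have n3 : (3 < n)%N by lia.
have -> : row i A = 2^-1 *: (row (Ordinal n0) A - row (Ordinal n3) A).
  apply/rowP => j; rewrite rowA.
  have -> (c : R) (u v : 'rV_n) : (c *: (u - v)) 0 j = c * (u 0 j - v 0 j) by rewrite !mxE.
  by rewrite !rowA; apply: entry_even_late => //; lia.
by rewrite scalemx_sub // addmx_sub ?eqmx_opp ?rowf //=; lia.
Qed.

Close Scope ring_scope.

Theorem theorem5p9 (R : realFieldType) (n : nat) (hn : 8 <= n) (k : nat) :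
  (exists Gam : signed_graph 'I_n,
      bicyclic (underlying Gam) /\ nullity R Gam = k)
  <-> k <= n - 4.
Proof.
split=> [[Gam [bGam <-]]|kn].
  by rewrite nullityE leq_sub2l // rank_bicyclic_ge4 // (leq_trans _ hn).
(* The rank n - k lies in [4, n] because k <= n - 4. *)
exists (model (n - k) n); split; first by apply: model_bicyclic; lia.
by rewrite nullityE model_rank; lia.
Qed.
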